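(* Let $G$ be a $15$-tough $(P_2\cup P_3)$-free graph with at least three vertices. Then $G$ is hamiltonian (i.e., $G$ has a cycle containing all its vertices).
   Context: All graphs are finite, simple and undirected. For a graph $G$, $c(G)$ denotes the number of components of $G$. For a real $t\ge 0$, $G$ is $t$-tough if $|S|\ge t\cdot c(G-S)$ for every $S\subseteq V(G)$ with $c(G-S)\ge 2$ (so a complete graph is $t$-tough for every $t$). $P_\ell$ denotes the path on $\ell$ vertices, and $P_2\cup P_3$ is the disjoint union of a $P_2$ and a $P_3$. A graph is $(P_2\cup P_3)$-free if it has no induced subgraph isomorphic to $P_2\cup P_3$. *)

(* Defs.v *)
From mathcomp Require Import all_boot all_order all_algebra.
From mathcomp Require Import reals.

Set Implicit Arguments.
Unset Strict Implicit.
Unset Printing Implicit Defensive.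

Record sgraph := SGraph {
  vertex :> finType;
  adj : rel vertex;
  adj_sym : symmetric adj;
  adj_irr : irreflexive adj }.

Definition isomorphic (G H : sgraph) : Prop :=
  exists2 f : G -> H, bijective f & {mono f : x y / adj x y}.

Section Induced.
Variables (G : sgraph) (A : {set G}).

Definition induced_adj : rel {x : G | x \in A} :=
  [rel u v | adj (val u) (val v)].

Lemma induced_sym : symmetric induced_adj.
Proof. by move=> u v; apply: adj_sym. Qed.

Lemma induced_irr : irreflexive induced_adj.
Proof. by move=> u; apply: adj_irr. Qed.

Definition induced : sgraph := SGraph induced_sym induced_irr.
End Induced.

Definition del_vertices (G : sgraph) (S : {set G}) : sgraph := induced (~: S).

Section PathGraph.
Variable l : nat.

Definition path_adj : rel 'I_l := [rel i j : 'I_l | (i.+1 == j) || (j.+1 == i)].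

Lemma path_sym : symmetric path_adj.
Proof. by move=> i j; apply: orbC. Qed.

Lemma path_irr : irreflexive path_adj.
Proof. by move=> i; rewrite /path_adj /= orbb gtn_eqF. Qed.

Definition path_graph : sgraph := SGraph path_sym path_irr.
End PathGraph.

Section DisjointUnion.
Variables G H : sgraph.

Definition dunion_adj : rel (G + H)%type := fun u v =>
  match u, v with
  | inl x, inl y => adj x y
  | inr x, inr y => adj x y
  | _, _ => false
  end.

Lemma dunion_sym : symmetric dunion_adj.
Proof. by case=> x [] y //=; apply: adj_sym. Qed.

Lemma dunion_irr : irreflexive dunion_adj.
Proof. by case=> x /=; apply: adj_irr. Qed.

Definition dunion : sgraph := SGraph dunion_sym dunion_irr.
End DisjointUnion.

Definition induced_free (H G : sgraph) : Prop :=
  ~ exists A : {set G}, isomorphic (induced A) H.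

Definition ncomponents (G : sgraph) : nat := n_comp (@adj G) G.

Definition tough (R : realType) (t : R) (G : sgraph) : Prop :=
  forall S : {set G}, 2 <= ncomponents (del_vertices S) ->
    (t * (ncomponents (del_vertices S))%:R <= #|S|%:R)%R.

(* [ucycle] also accepts the empty sequence and an edge traversed back and
   forth; the size bound excludes them. *)
Definition is_cycle (G : sgraph) (c : seq G) : Prop :=
  ucycle (@adj G) c /\ 3 <= size c.

Definition hamiltonian (G : sgraph) : Prop :=
  exists2 c : seq G, is_cycle c & forall x : G, x \in c.

(* Main.v *)
Require Import Defs.
From mathcomp Require Import all_boot all_order all_algebra.
From mathcomp Require Import reals zify.

Set Implicit Arguments.
Unset Strict Implicit.
Unset Printing Implicit Defensive.

(** Let n = #|G|, call a vertex heavy if its degree is at least n/2, and let G'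
be G with all heavy vertices made adjacent; by Ore's exchange argument it is
enough to find a hamiltonian cycle of G'. Let c be a cycle of G' that cannot be
enlarged and u a vertex off c, and call X the set of successors on c of the
neighbours of u. By the usual rerouting X and u form an independent set, and
by toughness an independent set has at most n/16 vertices, so u has degree less
than n/16. If the component of u off c contained an edge of G, then the vertices
not adjacent to that component would induce a disjoint union of cliques, each
containing at most one successor of an attachment of the component, and
removing the attachments would leave too many components: so all neighbours
of u are on c.

If w is a non-heavy neighbour of u with successor x, then u w x is an induced
P3, so the vertices adjacent to none of u, w, x are independent, and x has
degree more than 6n/16. On the other hand two elements of X share at most n/16
neighbours, because on the rerouted path that joins them the successors of
their common neighbours are independent. Hence u has at most three non-heavy
neighbours. Vertices of this kind ("light") all lie on one cycle of G': by
toughness and Hall's theorem each has two private heavy neighbours, and heavy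
vertices are adjacent in G'. Starting from that cycle, the enlargement
process cannot stop before the cycle is hamiltonian. *)

(** * Walks and rerouting of cycles *)

Section Walks.
Variables (T : eqType) (e : rel T).
Hypotheses (e_sym : symmetric e) (e_irr : irreflexive e).
Implicit Types (x y z t w : T) (s p q c : seq T).

(** Both ends belong to [s], so walks are joined and reversed as plain lists, and reroutings are
    compared by [perm_eq]. *)
Definition walk x y s :=
  if s is z :: p then [&& z == x, path e z p & last z p == y] else false.

Lemma walk_cat x y z t s p :
  walk x y s -> e y z -> walk z t p -> walk x t (s ++ p).
Proof.
case: s p => [|a s] // [|b p] //= /and3P[-> ps /eqP ly] eyz /and3P[/eqP-> pp lt].
by rewrite cat_path ps last_cat /= ly eyz pp lt.
Qed.

Lemma walk1 x : walk x x [:: x].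
Proof. by rewrite /= eqxx. Qed.

Lemma walk_last x y s : walk x y s -> y \in s.
Proof. by case: s => [|a s] //= /and3P[_ _ /eqP<-]; apply: mem_last. Qed.

Lemma walk_head x y s : walk x y s -> x \in s.
Proof. by case: s => [|a s] //= /andP[/eqP-> _]; apply: mem_head. Qed.

Lemma walk_rev x y s : walk x y s -> walk y x (rev s).
Proof.
elim: s x => [|a s IH] x //= /and3P[/eqP-> ps ly].
case: s IH ps ly => [|b s] IH /=; first by move=> _ /eqP->; apply: walk1.
case/andP=> exb ps ly; rewrite rev_cons -cats1.
apply: (@walk_cat _ b x _ _ _ _ _ (walk1 x)); last by rewrite e_sym.
by apply: IH; rewrite /= eqxx ps ly.
Qed.

Lemma walk_cycle x y s : walk x y s -> e y x -> cycle e s.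
Proof.
by case: s => [|a s] //= /and3P[/eqP-> ps /eqP ly] eyx; rewrite rcons_path ps ly.
Qed.

Lemma next_cat_cons p z t q : uniq (p ++ z :: t :: q) ->
  next (p ++ z :: t :: q) z = t.
Proof. by move=> U; rewrite -(next_rot (size p) U) rot_size_cat /= eqxx. Qed.

(** The last clause reads [next] in a longer list around [s]: a segment can be split while
    successors still refer to the whole walk. *)
Lemma walk_split x y s z : walk x y s -> z \in s -> z != y ->
  exists t s1 s2, [/\ s = s1 ++ s2, walk x z s1, walk t y s2, e z t
    & forall p q, uniq (p ++ s ++ q) -> next (p ++ s ++ q) z = t].
Proof.
move=> ws zs; case/splitPr: zs ws => p [|t q] ws.
  case/negP; move: ws; case: p => [|a p] /=.
    by case/andP=> _.
  by rewrite last_cat /= => /and3P[].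
move=> _; exists t, (rcons p z), (t :: q).
have nt r r' : uniq (r ++ (p ++ z :: t :: q) ++ r') ->
    next (r ++ (p ++ z :: t :: q) ++ r') z = t.
  by rewrite -catA catA => /next_cat_cons.
rewrite cat_rcons; move: ws; case: p nt => [|a p] nt /=.
  by case/and3P=> -> /andP[-> ->] ->; rewrite !eqxx.
rewrite cat_path last_cat /= => /and3P[-> /and4P[pp lz ezt pq] ->].
by rewrite rcons_path pp lz last_rcons !eqxx pq ezt.
Qed.

Lemma cycle_walk c w : cycle e c -> uniq c -> w \in c ->
  exists c', [/\ perm_eq c' c, walk (next c w) w c' & next c' =1 next c].
Proof.
move=> cc uc wc; case: (rot_to wc) => i s rs.
have us : uniq (w :: s) by rewrite -rs rot_uniq.
(* [rot i] brings [w] to the front, and [rot 1] then sends it to the end. *)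
exists (rot 1 (rot i c)); split.
- by rewrite !perm_rot.
- rewrite -(next_rot i uc) rs /rot /= drop0.
  have : cycle e (w :: s) by rewrite -rs rot_cycle.
  case: s us {rs} => [|b s] us /=; first by rewrite !eqxx.
  rewrite rcons_path cats1 rcons_path last_rcons.
  by case/and3P=> _ -> ->; rewrite !eqxx.
- by move=> z; rewrite next_rot ?rot_uniq // next_rot.
Qed.

Lemma cycle_insert c w h h' q :
  ucycle e c -> w \in c -> walk h h' q -> e w h ->
  exists p, perm_eq p (q ++ c) /\ walk (next c w) h' p.
Proof.
case/andP=> cc uc wc wq ewh; have [c' [pc wc' _]] := cycle_walk cc uc wc.
exists (c' ++ q); split; last exact: walk_cat wc' ewh wq.
by rewrite perm_catC perm_cat2l.
Qed.

(** The walk runs along [c] from [next c w] to [w'], through [q] backwards, then from [w] backwards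
    to [next c w']. *)
Lemma cycle_detour c w w' h h' q :
  ucycle e c -> w \in c -> w' \in c -> w' != w ->
  walk h h' q -> e w h -> e w' h' ->
  exists p, perm_eq p (q ++ c) /\ walk (next c w) (next c w') p.
Proof.
case/andP=> cc uc wc wc' nww wq ewh ewh'.
have [c' [pc wkc nc]] := cycle_walk cc uc wc.
have w'c' : w' \in c' by rewrite (perm_mem pc).
have [t [s1 [s2 [Ec ws1 ws2 ewt nt]]]] := walk_split wkc w'c' nww.
have {nt} Et : next c w' = t by rewrite -nc -(nt [::] [::]) cats0 ?(perm_uniq pc).
rewrite Et; exists (s1 ++ rev q ++ rev s2); split.
  rewrite perm_catCA; apply: perm_cat; first by rewrite perm_rev perm_refl.
  by apply: perm_trans pc; rewrite Ec perm_cat2l perm_rev perm_refl.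
apply: (walk_cat ws1 ewh'); apply: walk_cat (walk_rev wq) _ (walk_rev ws2).
by rewrite e_sym.
Qed.

(** If a cycle [c] cannot be enlarged, every list containing [c] and some vertex off [c] has this
    property. *)
Definition unclosable s :=
  forall c, ucycle e c -> {subset s <= c} -> False.

Lemma unclosable_ends x y s : unclosable s -> uniq s -> walk x y s -> ~~ e x y.
Proof.
move=> ns us ws; apply/negP => exy; apply: (ns s) => //.
by rewrite /ucycle us (walk_cycle ws) // e_sym.
Qed.

Lemma unclosable_common x y s z :
  unclosable s -> uniq s -> walk x y s -> e x z -> e y z -> z \in s.
Proof.
move=> ns us ws exz eyz; apply/negPn/negP => zs; apply: (ns (s ++ [:: z])).
  have wz := walk_cat ws eyz (walk1 z).
  by rewrite /ucycle (walk_cycle wz) ?[e z x]e_sym // cat_uniq us /= orbF zs.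
by move=> t ts; rewrite mem_cat ts.
Qed.

(* If z precedes z' on s, then an edge joining their successors yields the
   cycle x .. z y .. next z' next z .. z' x. *)
Lemma unclosable_next x y s z z' :
  unclosable s -> uniq s -> walk x y s ->
  e x z -> e y z -> e x z' -> e y z' -> ~~ e (next s z) (next s z').
Proof.
move=> ns us ws exz eyz exz' eyz'.
have ney t : e y t -> t != y by apply: contraTneq => ->; rewrite e_irr.
have zs := unclosable_common ns us ws exz eyz.
have zs' := unclosable_common ns us ws exz' eyz'.
have main a b s1 s2 : s = s1 ++ s2 -> walk x a s1 -> walk (next s a) y s2 ->
    e y a -> e x b -> e y b -> b \in s2 -> ~~ e (next s a) (next s b).
  move=> Es w1 w2 eya exb eyb bs2; apply/negP => enn.
  have [t [s3 [s4 [E2 w3 w4 _ nt]]]] := walk_split w2 bs2 (ney _ eyb).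
  have {nt} Et : next s b = t by rewrite -(nt s1 [::]) cats0 -Es.
  rewrite Et e_sym in enn.
  have wc : walk x b (s1 ++ rev s4 ++ s3).
    apply: (walk_cat w1 (z := y)); first by rewrite e_sym.
    exact: walk_cat (walk_rev w4) enn w3.
  have Pc : perm_eq (s1 ++ rev s4 ++ s3) s.
    by rewrite Es E2 perm_cat2l perm_catC perm_cat2l perm_rev perm_refl.
  apply: (ns (s1 ++ rev s4 ++ s3)) => [|u]; last by rewrite (perm_mem Pc).
  by rewrite /ucycle (walk_cycle wc) 1?e_sym // (perm_uniq Pc).
have [t [s1 [s2 [Es w1 w2 ezn nt]]]] := walk_split ws zs (ney _ eyz).
have {nt} Et : next s z = t by rewrite -(nt [::] [::]) cats0.
subst t.
have := zs'; rewrite {1}Es mem_cat => /orP[zs1|]; last by apply: (main z z' s1 s2).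
have [<-|nzz] := eqVneq z' z; first by rewrite e_irr.
have [t [s3 [s4 [E1 w3 w4 _ nt]]]] := walk_split w1 zs1 nzz.
have {nt} Et : next s z' = t by rewrite Es -(nt [::] s2) // -Es.
rewrite e_sym; apply: (main z' z s3 (s4 ++ s2)) => //.
- by rewrite catA -E1.
- by rewrite Et; apply: walk_cat w4 ezn w2.
- by rewrite mem_cat (walk_last w4).
Qed.


End Walks.

(** * Ore's exchange argument *)

Section Ore.
Variables (T : finType) (adj e : rel T).
Hypotheses (adj_sym : symmetric adj) (adj_irr : irreflexive adj).
Hypotheses (e_sym : symmetric e) (adj_e : subrel adj e).
Hypothesis deg_large : forall x y, e x y -> ~~ adj x y ->
  #|T| <= 2 * #|[set z | adj x z]|.
Implicit Types (x y z t w : T) (s p q c : seq T).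

(** Counts the steps of a walk that are not edges of [adj]; the exchange argument lowers this
    number. *)
Definition gaps s :=
  if s is x :: p then count id (pairmap (fun u v => ~~ adj u v) x p) else 0.

Lemma gaps_cat x y z t s p : walk e x y s -> walk e z t p ->
  gaps (s ++ p) = gaps s + ~~ adj y z + gaps p.
Proof.
case: s p => [|a s] // [|b p] //= /and3P[_ _ /eqP ly] /and3P[/eqP-> _ _].
by rewrite pairmap_cat count_cat /= ly addnA.
Qed.

Lemma gaps_rev x y s : walk e x y s -> gaps (rev s) = gaps s.
Proof.
elim: s x => [|a [|b s] IH] x //= /and3P[/eqP-> /andP[exb ps] ly].
have wb : walk e b y (b :: s) by rewrite /= eqxx ps ly.
rewrite rev_cons -cats1 (gaps_cat (walk_rev e_sym wb) (walk1 e x)) (IH b) //.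
by rewrite /= [adj b x]adj_sym addn0 addnC.
Qed.

Lemma gaps_split x y s : walk e x y s -> walk adj x y s \/
  exists a b s1 s2, [/\ s = s1 ++ s2, walk e x a s1, walk e b y s2, e a b
                      & ~~ adj a b].
Proof.
elim: s x => [|a [|b s] IH] x //=; first by move=> ->; left.
case/and3P=> /eqP-> /andP[exb ps] ly; have [axb|naxb] := boolP (adj x b).
  have [|/and3P[_ ps' _]|] := IH b; first by rewrite /= eqxx ps.
    by left; rewrite eqxx ps' ly.
  move=> [c [d [s1 [s2 [Es w1 w2 ecd ncd]]]]]; right.
  exists c, d, (x :: s1), s2; split => //; first by rewrite Es.
  exact: (walk_cat (walk1 e x)) exb w1.
by right; exists x, b, [:: x], (b :: s); split; rewrite //= ?eqxx // ps.
Qed.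

(** Pigeonhole: the neighbours of [x] and the successors of the neighbours of [y] both avoid [x],
    yet their numbers add up to at least [#|T|]. So they share some [t], and [z] is its
    predecessor. *)
Lemma ore_swap x y s : walk e x y s -> uniq s -> (forall z, z \in s) ->
    e y x -> ~~ adj y x ->
  exists z t s1 s2, [/\ s = s1 ++ s2, walk e x z s1, walk e t y s2, adj y z
                      & adj t x].
Proof.
move=> ws us ss eyx nayx.
pose A := [set z | adj x z]; pose B := [set z | adj y z].
have split z : adj y z -> exists s1 s2,
    [/\ s = s1 ++ s2, walk e x z s1 & walk e (next s z) y s2].
  move=> ayz; have zy : z != y by apply: contraTneq ayz => ->; rewrite adj_irr.
  have [t [s1 [s2 [Es w1 w2 _ nt]]]] := walk_split ws (ss z) zy.
  by exists s1, s2; rewrite -(nt [::] [::]) cats0 in w2.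
have sA : A \subset [set~ x].
  by apply/subsetP => z; rewrite !inE; apply: contraTneq => ->; rewrite adj_irr.
have sB : next s @: B \subset [set~ x].
  apply/subsetP => _ /imsetP[z + ->]; rewrite !inE => /split[s1 [s2 [Es w1 w2]]].
  apply: contraTneq us => nx; rewrite Es cat_uniq; apply/and3P=> -[_ /hasPn H _].
  by move: (H _ (walk_head w2)); rewrite /= nx (walk_head w1).
have cB : #|next s @: B| = #|B|.
  by apply: card_imset; apply: can_inj (prev_next us).
have : 0 < #|A :&: (next s @: B)|.
  have dA : #|T| <= 2 * #|A| by apply: (@deg_large _ y); rewrite 1?e_sym 1?adj_sym.
  have dB : #|T| <= 2 * #|B| by apply: (@deg_large _ x).
  have sU : A :|: (next s @: B) \subset [set~ x] by rewrite subUset sA.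
  have := subset_leq_card sU; rewrite cardsC1.
  have := cardsUI A (next s @: B); rewrite cB.
  have : 0 < #|T| by apply/card_gt0P; exists x.
  lia.
case/card_gt0P=> t /setIP[+ /imsetP[z + Et]]; rewrite !inE => axt ayz.
have [s1 [s2 [Es w1 w2]]] := split z ayz.
by exists z, t, s1, s2; split=> //; rewrite ?Et // adj_sym -Et.
Qed.

(** Induction on the number of cycle edges outside [adj]. Such an edge is rotated into closing
    position; the swap then trades it and the edge from [z] to [t] for two edges of [adj]. *)
Lemma ore_closure c : ucycle e c -> (forall z, z \in c) -> c != [::] ->
  exists2 c', ucycle adj c' & forall z, z \in c'.
Proof.
case/andP; case: c => // x c cc uc sc _.
have [c' [pc ws _]] := cycle_walk cc uc (mem_head x c).
have {uc} us : uniq c' by rewrite (perm_uniq pc).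
have {sc} ss z : z \in c' by rewrite (perm_mem pc).
have {cc} en : e x (next (x :: c) x) by apply: next_cycle => //; rewrite mem_head.
move: (next _ _) ws en => y {c pc}.
have [m] := ubnP (gaps c' + ~~ adj x y).
elim: m x y c' us ss => // m IH y x s us ss ltm ws eyx.
have swap u v p : perm_eq p s -> walk e u v p -> e v u -> ~~ adj v u ->
    gaps p < m -> exists2 c', ucycle adj c' & forall z, z \in c'.
  move=> ps wp evu nvu lt.
  have up : uniq p by rewrite (perm_uniq ps).
  have sp z : z \in p by rewrite (perm_mem ps).
  have [z [t [s1 [s2 [Ep w1 w2 avz atu]]]]] := ore_swap wp up sp evu nvu.
  have azv : adj z v by rewrite adj_sym.
  have w2r := walk_rev e_sym w2.
  have pp : perm_eq (s1 ++ rev s2) p by rewrite Ep perm_cat2l perm_rev perm_refl.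
  apply: (IH t u (s1 ++ rev s2)).
  - by rewrite (perm_uniq pp).
  - by move=> r; rewrite (perm_mem pp).
  - rewrite (gaps_cat w1 w2r) (gaps_rev w2) azv atu !addn0.
    apply: leq_ltn_trans lt; rewrite Ep (gaps_cat w1 w2).
    by rewrite -addnA leq_add2l leq_addl.
  - by apply: walk_cat w1 _ w2r; apply: adj_e.
  - exact: adj_e.
have [ayx|nayx] := boolP (adj y x); last first.
  by apply: (swap x y s) => //;  move: ltm; rewrite nayx addn1.
have [wa|[a [b [s1 [s2 [Es w1 w2 eab nab]]]]]] := gaps_split ws.
  by exists s => //; rewrite /ucycle us (walk_cycle wa).
apply: (swap b a (s2 ++ s1)) => //.
- by rewrite Es perm_catC perm_refl.
- exact: walk_cat w2 eyx w1.
- move: ltm; rewrite Es (gaps_cat w1 w2) nab (gaps_cat w2 w1) ayx.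
  by rewrite !addn0 addn1 addSn addnC.
Qed.
End Ore.

(** * Finite sets and Hall's theorem *)

Lemma bonferroni4 (K : finType) (A B C D : {set K}) :
  #|A| + #|B| + #|C| + #|D| <= #|K| + (#|A :&: B| + #|A :&: C| + #|A :&: D|
    + #|B :&: C| + #|B :&: D| + #|C :&: D|).
Proof.
have := cardsUI A B; have := cardsUI (A :|: B) C.
have := cardsUI (A :|: B :|: C) D; rewrite !setIUl.
have := (leq_card_setU (A :&: C) (B :&: C)).1.
have := (leq_card_setU (A :&: D :|: B :&: D) (C :&: D)).1.
have := (leq_card_setU (A :&: D) (B :&: D)).1.
have : #|A :|: B :|: C :|: D| <= #|K| by apply: max_card.
lia.
Qed.

Lemma card_bigcup_le (J K : finType) (P : pred J) (F : J -> {set K}) m :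
  (forall j, P j -> #|F j| <= m) -> #|\bigcup_(j | P j) F j| <= #|P| * m.
Proof.
move=> Fm; apply: (@leq_trans (\sum_(j | P j) #|F j|)).
  elim/big_rec2: _ => [|j a A _ le]; first by rewrite cards0.
  by apply: leq_trans (leq_card_setU _ _).1 _; rewrite leq_add2l.
by rewrite -sum_nat_const; apply: leq_sum.
Qed.

Section Hall.
Variables (I T : finType).
Implicit Types (A : I -> {set T}) (J K : {set I}).

Definition hall_condition A := forall J, #|J| <= #|\bigcup_(i in J) A i|.

Definition remove A i0 a := fun i => if i == i0 then A i :\ a else A i.

Lemma remove_notin A i0 a J : i0 \notin J ->
  \bigcup_(i in J) remove A i0 a i = \bigcup_(i in J) A i.
Proof.
move=> iJ; apply: eq_bigr => i Ji; rewrite /remove.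
by case: eqP Ji iJ => [-> ->|].
Qed.

(* Rado: violations J (after removing a) and K (after removing b) would
   contradict Hall's condition for J :|: K or for (J :&: K) :\ i0. *)
Lemma hall_remove A i0 a b : hall_condition A -> a != b ->
  hall_condition (remove A i0 a) \/ hall_condition (remove A i0 b).
Proof.
move=> hA ab.
have [/forallP ha|] :=
  boolP [forall J : {set I}, #|J| <= #|\bigcup_(i in J) remove A i0 a i|].
  by left.
have [/forallP hb|] :=
  boolP [forall J : {set I}, #|J| <= #|\bigcup_(i in J) remove A i0 b i|].
  by right.
rewrite !negb_forall => /existsP[K]; rewrite -ltnNge => ltK /existsP[J].
rewrite -ltnNge => ltJ; exfalso.
have iJ : i0 \in J.
  by apply: contraLR ltJ => /remove_notin->; rewrite -leqNgt.
have iK : i0 \in K.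
  by apply: contraLR ltK => /remove_notin->; rewrite -leqNgt.
set P := \bigcup_(i in J) _ in ltJ; set Q := \bigcup_(i in K) _ in ltK.
have sU : \bigcup_(i in J :|: K) A i \subset P :|: Q.
  apply/bigcupsP => i; rewrite inE => JKi; apply/subsetP => x Ax.
  have [ii0|ni] := eqVneq i i0.
    have [xa|nxa] := eqVneq x a; rewrite inE; apply/orP; [right|left];
      apply/bigcupP; exists i0; rewrite // /remove eqxx !inE -ii0 Ax andbT //.
    by rewrite xa.
  by case/orP: JKi => Xi; rewrite inE; apply/orP; [left|right];
    apply/bigcupP; exists i; rewrite // /remove (negPf ni).
have sI : \bigcup_(i in (J :&: K) :\ i0) A i \subset P :&: Q.
  apply/bigcupsP => i; rewrite !inE => /and3P[ni Ji Ki]; apply/subsetP => x Ax.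
  by rewrite inE; apply/andP; split; apply/bigcupP; exists i;
    rewrite // /remove (negPf ni).
(* The violations give [#|P| + #|Q| <= #|J| + #|K| - 2], while Hall's condition on the two sets
   gives at least [#|J| + #|K| - 1], only [i0] being lost. *)
have := hA (J :|: K); have := hA ((J :&: K) :\ i0).
have := subset_leq_card sU; have := subset_leq_card sI.
have := cardsUI J K; have := cardsUI P Q; have := cardsD1 i0 (J :&: K).
rewrite inE iJ iK /=; lia.
Qed.

(** Induction on the total size: as long as some set has two elements, one of them can be deleted.
    Once all sets are singletons, the condition on pairs makes the choice injective. *)
Lemma hall A : hall_condition A -> exists2 f, injective f & forall i, f i \in A i.
Proof.
have [m] := ubnP (\sum_i #|A i|); elim: m A => // m IH A ltm hA.
have [/existsP[i0 /card_gt1P[a [b [Aa Ab ab]]]]|] := boolP [exists i, 1 < #|A i|].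
  have red c : c \in A i0 -> hall_condition (remove A i0 c) ->
      exists2 f, injective f & forall i, f i \in A i.
    move=> Ac hc; have [|//|f fI fA] := IH (remove A i0 c); last first.
      exists f => // i; have := fA i; rewrite /remove; case: ifP => //.
      by rewrite inE => _ /andP[].
    move: ltm; rewrite (bigD1 i0) //= [in X in _ -> X](bigD1 i0) //=.
    rewrite {1}/remove eqxx (cardsD1 c) Ac.
    rewrite [in X in _ -> X](eq_bigr (fun i => #|A i|)); first by lia.
    by move=> i /negPf ni; rewrite /remove ni.
  by case: (hall_remove i0 hA ab); apply: red.
rewrite negb_exists => /forallP A1.
have A_gt0 i : 0 < #|A i| by have := hA [set i]; rewrite cards1 big_set1.
have [f fA] : {f : I -> T | forall i, f i \in A i}.
  have Ai i : {x | x \in A i}.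
    case: (pickP [pred x in A i]) => [x Ax|A0]; first by exists x.
    by have := A_gt0 i; rewrite eq_card0.
  by exists (fun i => sval (Ai i)) => i; case: (Ai i).
exists f => // i j fij; apply/eqP; apply/negPn/negP => nij.
have := hA [set i; j]; rewrite cards2 nij bigcup_setU !big_set1 leqNgt.
suff -> : #|A i :|: A j| = #|A i| by rewrite ltnS leqNgt A1.
congr #|pred_of_set _|; apply/setUidPl/subsetP => x Ax.
have := A1 j; rewrite -leqNgt => /card_le1_eqP H.
have -> : x = f j by apply: H.
by rewrite -fij.
Qed.
End Hall.

(** * Toughness and induced subgraphs *)

Section Graph.
Variable G : sgraph.
Implicit Types (x y z u v w : G) (S I : {set G}).

Definition nbr v := [set x | adj v x].
Definition nbrs I := \bigcup_(v in I) nbr v.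
Definition indep I := {in I &, forall x y, ~~ adj x y}.

Lemma in_nbr v x : (x \in nbr v) = adj v x. Proof. by rewrite inE. Qed.

(** If [p] or [q] is one of [a], [b], [c], a listed adjacency holds at once, so the content concerns
    five distinct vertices. *)
Definition free23 := forall a b c p q : G,
  adj a b -> adj b c -> ~~ adj a c -> a != c -> adj p q ->
  [|| adj p a, adj p b, adj p c, adj q a, adj q b | adj q c].

Lemma induced_free23 :
  induced_free (dunion (path_graph 2) (path_graph 3)) G -> free23.
Proof.
move=> fr a b c p q ab bc nac ac pq; apply/negPn/negP.
rewrite !negb_or => /and5P[pa pb pc qa /andP[qb qc]]; apply: fr.
pose g (x : dunion (path_graph 2) (path_graph 3)) : G :=
  match x with
  | inl i => if val i is 0 then p else q
  | inr i => match val i with 0 => a | 1 => b | _ => c end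
  end.
have gm : {mono g : x y / adj x y}.
  case=> [] [[|[|[|i]]] //= Hi] [] [[|[|[|j]]] //= Hj];
    rewrite /= ?adj_irr //; apply/idP; try (by []); try (by rewrite adj_sym);
    apply/negP; try (by []); by rewrite adj_sym.
have gI : injective g.
  have adj_neq x y z : adj x y -> ~~ adj z y -> x != z.
    by move=> xy; apply: contraNneq => <-.
  have qp : adj q p by rewrite adj_sym.
  have ba : adj b a by rewrite adj_sym.
  have neq : [&& p != q, p != a, p != b, p != c &
      [&& q != a, q != b, q != c, a != b & b != c]].
    rewrite (adj_neq p q) ?adj_irr //.
    rewrite (adj_neq p q a) 1?[adj a q]adj_sym //.
    rewrite (adj_neq p q b) 1?[adj b q]adj_sym //.
    rewrite (adj_neq p q c) 1?[adj c q]adj_sym //.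
    rewrite (adj_neq q p a) 1?[adj a p]adj_sym //.
    rewrite (adj_neq q p b) 1?[adj b p]adj_sym //.
    rewrite (adj_neq q p c) 1?[adj c p]adj_sym //.
    by rewrite (adj_neq a b) ?adj_irr // (adj_neq b c) ?adj_irr.
  move: neq => /and5P[npq npa npb npc /and5P[nqa nqb nqc nab nbc]].
  case=> [] [[|[|[|i]]] //= Hi] [] [[|[|[|j]]] //= Hj] /= E;
    try (by congr (inl _); apply: val_inj); try (by congr (inr _); apply: val_inj);
    exfalso; move/eqP: E; apply/negP => //; by rewrite eq_sym.
pose A : {set G} := g @: setT.
have gA (x : dunion (path_graph 2) (path_graph 3)) : g x \in A by apply: imset_f.
pose h (x : dunion (path_graph 2) (path_graph 3)) : induced A := Sub (g x) (gA x).
have hI : injective h by move=> x y /(congr1 val) /gI.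
have [f hf fh] : bijective h.
  apply: inj_card_bij => //.
  by rewrite card_sig -[X in _ <= X]cardsT -(card_imset _ gI); apply/eq_leq/eq_card.
exists A, f; first by exists h.
by move=> x y; rewrite -gm -[in RHS](fh x) -[in RHS](fh y).
Qed.

(* A labelling phi constant along the edges of G - S separates components, so
   a set I on which it is injective bounds their number from below. *)
Definition tough_nat t := forall S I (K : eqType) (phi : G -> K),
  [disjoint I & S] ->
  (forall x y, x \notin S -> y \notin S -> adj x y -> phi x = phi y) ->
  {in I &, injective phi} -> 1 < #|I| -> t * #|I| <= #|S|.

(** As [phi] is constant on the components of [G - S], sending each vertex of [I] to the root of its
    component is injective. *)
Lemma toughP (R : realType) (t : nat) : tough (t%:R : R)%R G -> tough_nat t.
Proof.
move=> tG S I K phi IS phiE phiI I1.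
have phiC (x y : del_vertices S) : connect (@adj _) x y -> phi (val x) = phi (val y).
  case/connectP=> p; elim: p x => [|z p IH] x /= => [_ ->//|/andP[xz pz] Ey].
  rewrite -(IH z pz Ey); apply: phiE xz.
    by have := valP x; rewrite inE.
  by have := valP z; rewrite inE.
have symC : connect_sym (@adj (del_vertices S)).
  by apply: sym_connect_sym; apply: adj_sym.
have le : #|I| <= ncomponents (del_vertices S).
  have notS x : x \in I -> x \in ~: S by move=> Ix; rewrite inE (disjointFr IS).
  pose h (x : {x | x \in I}) : del_vertices S :=
    fingraph.root (@adj (del_vertices S)) (Sub (val x) (notS _ (valP x))).
  have hI : injective h.
    move=> x y /eqP; rewrite /h (root_connect symC) => /phiC /= /phiI exy.
    by apply/val_inj/exy; apply: valP.
  rewrite -[#|I|]card_sig -(card_imset _ hI); apply: subset_leq_card.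
  by apply/subsetP => _ /imsetP[x _ ->]; rewrite !inE roots_root.
have := tG S (leq_trans I1 le); rewrite -GRing.natrM Num.Theory.ler_nat.
by apply: leq_trans; rewrite leq_mul2l le orbT.
Qed.

End Graph.

(** * Tough (P2 u P3)-free graphs *)

Section ToughFree.
Variable G : sgraph.
Hypotheses (toughG : tough_nat G 15) (freeG : free23 G).
Implicit Types (x y z u v w : G) (S I : {set G}) (c s : seq G).

(** Deleting everything outside [I] leaves [#|I|] isolated vertices. *)
Lemma indep_card I : indep I -> 1 < #|I| -> 16 * #|I| <= #|G|.
Proof.
move=> Iind I1; suff : 15 * #|I| <= #|~: I| by have := cardsC I; lia.
apply: (@toughG (~: I) I G id) => //; first by rewrite -setI_eq0 setICr.
by move=> x y; rewrite !inE !negbK => Ix Iy; rewrite (negPf (Iind x y Ix Iy)).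
Qed.

Lemma indep_nbrs I : indep I -> 1 < #|I| -> 15 * #|I| <= #|nbrs I|.
Proof.
move=> Iind I1.
have nI x y : x \in I -> y \notin nbrs I -> adj x y = false.
  by move=> Ix; apply: contraNF => xy; apply/bigcupP; exists x; rewrite ?inE.
(* Deleting the neighbours of [I] isolates each vertex of [I]; [None] labels everything else. *)
apply: (@toughG _ I _ (fun x => if x \in I then Some x else None)) => //.
- apply/pred0P => x /=; apply/negP => /andP[Ix /bigcupP[y Iy]].
  by rewrite inE; apply/negP/Iind.
- move=> x y Sx Sy xy; case: ifP => [Ix|_]; first by rewrite nI in xy.
  by case: ifP => // Iy; rewrite adj_sym nI in xy.
- by move=> x y -> -> [].
Qed.

Lemma nonadj_deg x y : x != y -> ~~ adj x y -> 30 <= #|nbr x|.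
Proof.
move=> nxy naxy.
have := @toughG (nbr x) [set x; y] bool (fun z => z == x).
rewrite cards2 nxy; apply=> //.
- apply/pred0P => z /=; rewrite !inE; apply/negP.
  by case/andP=> /orP[] /eqP->; rewrite ?adj_irr // (negPf naxy).
- move=> u v; rewrite !in_nbr => xu xv uv.
  by apply/eqP/eqP => E; subst; rewrite ?uv // adj_sym uv in xu xv.
- move=> u v; rewrite !inE => /orP[]/eqP-> /orP[]/eqP-> //=;
  by rewrite eqxx eq_sym (negPf nxy).
Qed.

Lemma nonadj_card x y : x != y -> ~~ adj x y -> 32 <= #|G|.
Proof.
move=> nxy naxy; have := @indep_card [set x; y]; rewrite cards2 nxy; apply=> //.
by move=> u v; rewrite !inE => /orP[]/eqP-> /orP[]/eqP->;
  rewrite ?adj_irr // adj_sym.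
Qed.

Definition heavy := [set v : G | #|G| <= 2 * #|nbr v|].
Definition cadj : rel G :=
  fun x y => adj x y || [&& x != y, x \in heavy & y \in heavy].

Lemma cadj_sym : symmetric cadj.
Proof. by move=> x y; rewrite /cadj adj_sym eq_sym [(x \in _) && _]andbC. Qed.

Lemma cadj_irr : irreflexive cadj.
Proof. by move=> x; rewrite /cadj adj_irr eqxx. Qed.

Lemma adj_cadj : subrel (@adj G) cadj.
Proof. by move=> x y xy; rewrite /cadj xy. Qed.

Lemma cadjN x y : ~~ cadj x y -> ~~ adj x y.
Proof. by apply: contraNN; apply: adj_cadj. Qed.

Definition light :=
  [set v : G | (16 * #|nbr v|.+1 <= #|G|) && (#|nbr v :\: heavy| <= 3)].

(** * Cycles of [G'] that cannot be enlarged *)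

Section MaximalCycle.
Variable c : seq G.
Hypotheses (cycle_c : ucycle cadj c) (c_n0 : c != [::]).
Hypothesis c_max : forall c', ucycle cadj c' -> {subset c <= c'} ->
  size c' <= size c.

Let uniq_c : uniq c. Proof. by case/andP: cycle_c. Qed.

Lemma unclosable_off s q :
  uniq s -> perm_eq s (q ++ c) -> q != [::] -> unclosable cadj s.
Proof.
move=> us ps q0 c' uc' ss.
have sc : {subset c <= c'}.
  by move=> x cx; apply: ss; rewrite (perm_mem ps) mem_cat cx orbT.
have := leq_trans (uniq_leq_size us ss) (c_max uc' sc).
by rewrite (perm_size ps) size_cat; case: q q0 {ps} => //= a q _; lia.
Qed.

Lemma off_walk_next h h' q w : walk cadj h h' q -> uniq (q ++ c) ->
  w \in c -> cadj w h -> ~~ cadj (next c w) h'.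
Proof.
move=> wq uq wc ewh; have [p [pp wp]] := cycle_insert cycle_c wc wq ewh.
have up : uniq p by rewrite (perm_uniq pp).
apply: (unclosable_ends cadj_sym (unclosable_off up pp _) up wp).
by case: q wq {uq pp}.
Qed.

Lemma off_walk_next2 h h' q w w' : walk cadj h h' q -> uniq (q ++ c) ->
  w \in c -> w' \in c -> w' != w -> cadj w h -> cadj w' h' ->
  exists p, [/\ uniq p, unclosable cadj p & walk cadj (next c w) (next c w') p].
Proof.
move=> wq uq wc wc' nww ewh ewh'.
have [p [pp wp]] := cycle_detour cadj_sym cycle_c wc wc' nww wq ewh ewh'.
have up : uniq p by rewrite (perm_uniq pp).
exists p; split=> //; apply: unclosable_off up pp _.
by case: q wq {uq}.
Qed.

(** * Components off a maximal cycle *)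

Section Component.
Variable u : G.
Hypothesis uc : u \notin c.

Let off : rel G := fun x y => [&& cadj x y, x \notin c & y \notin c].
(** [H] is the component of [u] in [G'] minus [c], [W] its set of attachments on [c], and [X] the
    set of their successors. *)
Let H := [set h | connect off u h].
Let W := [set w in c | [exists h in H, cadj w h]].
Let X := [set next c w | w in W].

Let off_sym : symmetric off.
Proof. by move=> x y; rewrite /off cadj_sym [(x \notin _) && _]andbC. Qed.

Let H_off h : h \in H -> h \notin c.
Proof.
rewrite inE => /connectP[p]; elim/last_ind: p => [_ ->//|p z _].
by rewrite rcons_path last_rcons => /andP[_ /and3P[_ _ zc]] ->.
Qed.

Let H_walk h h' : h \in H -> h' \in H ->
  exists q, walk cadj h h' q /\ uniq (q ++ c).
Proof.
move=> Hh Hh'; have : connect off h h'.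
  move: Hh Hh'; rewrite !inE => uh; apply: connect_trans.
  by rewrite sym_connect_sym.
case/connectP=> p0 /shortenP[p pp up _] ->; exists (h :: p); split.
  rewrite /= !eqxx andbT /=; apply: sub_path pp => x y.
  by case/and3P.
rewrite cat_uniq up uniq_c andbT /=; apply/hasPn => x xc; apply/negP => xp.
have /negP[] : x \notin c; last exact: xc.
move: xp; rewrite inE => /orP[/eqP->|xp]; first exact: H_off.
move: pp; case/splitPr: xp => p1 p2; rewrite cat_path /= => /and3P[_ + _].
by case/and3P.
Qed.

Let X_H x h : x \in X -> h \in H -> ~~ cadj x h.
Proof.
case/imsetP=> w; rewrite inE => /andP[wc /exists_inP[h' Hh' ewh]] -> Hh.
have [q [wq uq]] := H_walk Hh' Hh; exact: off_walk_next wq uq wc ewh.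
Qed.

Let X_indep x x' : x \in X -> x' \in X -> ~~ cadj x x'.
Proof.
case/imsetP=> w; rewrite inE => /andP[wc /exists_inP[h Hh ewh]] ->.
case/imsetP=> w'; rewrite inE => /andP[wc' /exists_inP[h' Hh' ewh']] ->.
have [->|nww] := eqVneq w' w; first by rewrite cadj_irr.
have [q [wq uq]] := H_walk Hh Hh'.
have [p [up np wp]] := off_walk_next2 wq uq wc wc' nww ewh ewh'.
exact: (unclosable_ends cadj_sym np up wp).
Qed.

Let out_H v h : v \notin H -> v \notin W -> h \in H -> ~~ cadj v h.
Proof.
move=> Hv Wv Hh; apply/negP => evh.
have [vc|vc] := boolP (v \in c).
  by case/negP: Wv; rewrite inE vc; apply/exists_inP; exists h.
case/negP: Hv; move: (Hh); rewrite !inE => /connect_trans; apply.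
by apply: connect1; rewrite /off cadj_sym evh vc H_off.
Qed.

Let uH : u \in H. Proof. by rewrite inE connect0. Qed.

(** Without attachments [G] is disconnected, and toughness for the empty set fails. *)
Let W_n0 : 0 < #|W|.
Proof.
rewrite lt0n; apply/negP => /eqP/cards0_eq W0.
have [z zc] : exists z, z \in c by case: c c_n0 => // z s _; exists z; rewrite mem_head.
have uz : u != z by apply: contraNneq uc => ->.
have Hz : z \notin H by apply: contraTN zc; apply: H_off.
suff : 15 * #|[set u; z]| <= #|@set0 G| by rewrite cards2 uz cards0.
apply: (@toughG set0 [set u; z] bool (fun v => v \in H)).
- by rewrite disjoint_sym disjoints_subset sub0set.
- have half x y : adj x y -> x \in H -> y \in H.
    move=> xy Hx; apply: contraTT xy => Hy; rewrite adj_sym; apply: cadjN.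
    by apply: out_H => //; rewrite W0 inE.
  by move=> x y _ _ xy; apply/idP/idP; apply: half; rewrite // adj_sym.
- move=> x y; rewrite !in_set2 => /orP[]/eqP-> /orP[]/eqP->; by rewrite ?uH ?(negPf Hz).
- by rewrite cards2 uz.
Qed.

(* Outside W the component H is separated from the rest, which is P3-free
   because of the edge ab, so the elements of X lie in distinct components. *)
Lemma component_no_edge a b : a \in H -> b \in H -> ~~ adj a b.
Proof.
move=> Ha Hb; apply/negP => ab.
have XH x : x \in X -> x \notin H.
  by case/imsetP=> w; rewrite inE => /andP[wc _] ->;
    apply: contraL (@H_off _) _; rewrite mem_next.
have XW x : x \in X -> x \notin W.
  move=> Xx; apply/negP; rewrite inE => /andP[_ /exists_inP[h Hh]].
  by apply/negP; apply: X_H.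
have cX : #|X| = #|W| by apply: card_imset; apply: can_inj (prev_next uniq_c).
have aX : a \notin X by apply: contraTN Ha; apply: XH.
(* The label is the closed neighbourhood outside [H] and [W], which is constant on the components of
   a P3-free graph. *)
pose phi v := if v \in H then set0 else
  [set y | [&& y \notin H, y \notin W & (y == v) || adj v y]].
suff : 15 * #|a |: X| <= #|W| by rewrite cardsU1 aX cX; have := W_n0; lia.
apply: (@toughG W (a |: X) _ phi).
- apply/pred0P => x /=; apply/negP => /andP[]; rewrite in_setU1.
  by case/orP=> [/eqP->|/XW/negPf->//]; rewrite inE (negPf (H_off Ha)).
- move=> x y Wx Wy xy; rewrite /phi.
  have [Hx|Hx] := boolP (x \in H); have [Hy|Hy] := boolP (y \in H) => //.
  + by case/negP: (out_H Hy Wy Hx); rewrite cadj_sym adj_cadj.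
  + by case/negP: (out_H Hx Wx Hy); rewrite adj_cadj.
  (* Were [t] adjacent to [v] but not to [v'], the induced P3 on [v'], [v], [t] would have no edge
     to [a] or [b]. *)
  have half v v' t : v \notin H -> v \notin W -> v' \notin H -> v' \notin W ->
      t \notin H -> t \notin W -> adj v v' -> (t == v) || adj v t ->
      (t == v') || adj v' t.
    move=> Hv Wv Hv' Wv' Ht Wt vv' /orP[/eqP->|vt]; first by rewrite adj_sym vv' orbT.
    apply/negPn/negP; rewrite negb_or => /andP[tv' v't].
    have nadj r h : r \notin H -> r \notin W -> h \in H -> adj h r = false.
      by move=> Hr Wr Hh; rewrite adj_sym; apply/negbTE/cadjN/out_H.
    have v'v : adj v' v by rewrite adj_sym.
    have nv't : v' != t by rewrite eq_sym.
    by have := freeG v'v vt v't nv't ab; rewrite !(nadj _ a) ?(nadj _ b).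
  apply/setP => t; rewrite 2!in_set; apply: andb_id2l => Ht; apply: andb_id2l => Wt.
  by apply/idP/idP; apply: half; rewrite // adj_sym.
- have phi_id x : x \in X -> x \in phi x.
    by move=> Xx; rewrite /phi (negPf (XH x Xx)) in_set XH // XW // eqxx.
  have phia : phi a = set0 by rewrite /phi Ha.
  move=> x y; rewrite !in_setU1 => /orP[/eqP->|Xx] /orP[/eqP->|Xy] //.
  + by rewrite phia => E; have := phi_id y Xy; rewrite -E in_set0.
  + by rewrite phia => E; have := phi_id x Xx; rewrite E in_set0.
  move=> E; have := phi_id y Xy; rewrite -E /phi (negPf (XH x Xx)) in_set.
  by rewrite (negPf (cadjN (X_indep Xx Xy))) orbF => /and3P[_ _ /eqP].
- by rewrite cardsU1 aX cX; have := W_n0; lia.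
Qed.

End Component.

Lemma off_nbr u v : u \notin c -> adj u v -> v \in c.
Proof.
move=> uc uv; apply/negPn/negP => vc; move: (uv); apply/negP.
apply: (component_no_edge uc); rewrite inE ?connect0 //.
by apply: connect1; rewrite adj_cadj ?uc.
Qed.

(** * Degrees around a vertex off a maximal cycle *)

Section OffVertex.
Variable u : G.
Hypothesis uc : u \notin c.

Let uniq_u : uniq ([:: u] ++ c). Proof. by rewrite /= uc uniq_c. Qed.

Let next_u w : w \in c -> cadj w u -> ~~ cadj (next c w) u.
Proof. exact: off_walk_next (walk1 cadj u) uniq_u. Qed.

Let next_walk w w' : w' != w -> adj u w -> adj u w' ->
  exists p, [/\ uniq p, unclosable cadj p & walk cadj (next c w) (next c w') p].
Proof.
move=> nww uw uw'; apply: (off_walk_next2 (walk1 cadj u) uniq_u) => //.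
- exact: off_nbr uw.
- exact: off_nbr uw'.
- by rewrite cadj_sym adj_cadj.
- by rewrite cadj_sym adj_cadj.
Qed.

Lemma off_nonadj : exists2 z, u != z & ~~ adj u z.
Proof.
have [z zc] : exists z, z \in c by case: c c_n0 => // z s _; exists z; rewrite mem_head.
have cu v : v \in c -> u != v by move=> vc; apply: contraNneq uc => ->.
have [uz|] := boolP (adj u z); last by exists z; rewrite ?cu.
exists (next c z); first by rewrite cu // mem_next.
by rewrite adj_sym; apply/cadjN/next_u; rewrite // cadj_sym adj_cadj.
Qed.

Lemma off_card : 32 <= #|G|.
Proof. by have [z] := off_nonadj; apply: nonadj_card. Qed.

Lemma off_indep_card I : indep I -> 16 * #|I| <= #|G|.
Proof.
move=> Iind; have [|I1] := ltnP 1 #|I|; first exact: indep_card.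
by apply: leq_trans off_card; lia.
Qed.

Lemma off_deg : 16 * #|nbr u|.+1 <= #|G|.
Proof.
have cX : #|next c @: nbr u| = #|nbr u|.
  by apply: card_imset; apply: can_inj (prev_next uniq_c).
have uX x : x \in next c @: nbr u -> ~~ adj u x.
  case/imsetP=> w; rewrite in_nbr => uw ->; rewrite adj_sym.
  by apply/cadjN/next_u; rewrite ?(off_nbr uc uw) // cadj_sym adj_cadj.
have uX' : u \notin next c @: nbr u.
  apply: contra uc => /imsetP[w]; rewrite in_nbr => uw ->.
  by rewrite mem_next (off_nbr uc uw).
have -> : #|nbr u|.+1 = #|u |: (next c @: nbr u)| by rewrite cardsU1 uX' cX.
apply: off_indep_card => x y.
rewrite !in_setU1 => /orP[/eqP->|Xx] /orP[/eqP->|Xy].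
- by rewrite adj_irr.
- exact: uX.
- by rewrite adj_sym uX.
move: Xx Xy => /imsetP[w + ->] /imsetP[w' + ->]; rewrite !in_nbr => uw uw'.
have [->|nww] := eqVneq w' w; first by rewrite adj_irr.
have [p [up np wp]] := next_walk nww uw uw'.
exact/cadjN/(unclosable_ends cadj_sym np up wp).
Qed.

(** On the walk through [u] and all of [c] that joins the two successors, the vertices following
    their common neighbours are independent. *)
Lemma off_common w w' : w' != w -> adj u w -> adj u w' ->
  16 * #|nbr (next c w) :&: nbr (next c w')| <= #|G|.
Proof.
move=> nww uw uw'; have [p [up np wp]] := next_walk nww uw uw'.
rewrite -(card_imset _ (can_inj (prev_next up))); apply: off_indep_card.
move=> _ _ /imsetP[z + ->] /imsetP[z' + ->].
rewrite !inE => /andP[xz yz] /andP[xz' yz']; apply: cadjN.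
by apply: (unclosable_next cadj_sym cadj_irr np up wp); apply: adj_cadj.
Qed.

(* u, w and next c w induce a P3, so the vertices outside their three
   neighbourhoods are independent. *)
Lemma off_next_deg w : adj u w -> w \notin heavy ->
  6 * #|G| < 16 * #|nbr (next c w)|.
Proof.
move=> uw wh; set x := next c w.
have wc := off_nbr uc uw.
(* Edges added in [G'] join heavy vertices, so this cycle edge lies in [G]. *)
have wx : adj w x.
  have : cadj w x by apply: next_cycle => //; case/andP: cycle_c.
  by rewrite /cadj (negPf wh) /= andbF orbF.
have ux : ~~ adj u x.
  by rewrite adj_sym; apply/cadjN/next_u; rewrite // cadj_sym adj_cadj.
have nux : u != x by apply: contraNneq uc => ->; rewrite mem_next.
pose M := ~: (nbr u :|: nbr w :|: nbr x).
have Mind : indep M.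
  move=> a b; rewrite !inE !negb_or => /andP[/andP[ua wa] xa] /andP[/andP[ub wb] xb].
  apply/negP => ab; have := freeG uw wx ux nux ab.
  by rewrite ![adj a _]adj_sym ![adj b _]adj_sym (negPf ua) (negPf wa) (negPf xa)
    (negPf ub) (negPf wb) (negPf xb).
(* With n the order of [G]: [M] has at most n/16 vertices, [u] has degree below n/16 and [w] below
   n/2, which leaves more than 6n/16 for [x]. *)
have := off_indep_card Mind; have := cardsC (nbr u :|: nbr w :|: nbr x).
rewrite -/M; have := off_deg; move: wh; rewrite inE -ltnNge.
have := (leq_card_setU (nbr u :|: nbr w) (nbr x)).1.
have := (leq_card_setU (nbr u) (nbr w)).1.
lia.
Qed.

(* Four sets of more than 6n/16 vertices which pairwise share at most n/16 do
   not fit into n vertices. *)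
Lemma off_light : u \in light.
Proof.
rewrite inE off_deg /= leqNgt; apply/negP => D4.
have /card_gt0P[w1 Dw1] : 0 < #|nbr u :\: heavy| by apply: leq_trans D4.
have : 2 < #|(nbr u :\: heavy) :\ w1| by move: D4; rewrite (cardsD1 w1) Dw1.
case/card_gt2P=> w2 [w3 [w4 [[]]]].
rewrite !in_setD1 => /andP[n21 Dw2] /andP[n31 Dw3] /andP[n41 Dw4] [n23 n34 n42].
move: Dw1 Dw2 Dw3 Dw4; rewrite !in_setD !in_nbr.
move=> /andP[h1 a1] /andP[h2 a2] /andP[h3 a3] /andP[h4 a4].
have := bonferroni4 (nbr (next c w1)) (nbr (next c w2)) (nbr (next c w3))
  (nbr (next c w4)).
have := off_next_deg a1 h1; have := off_next_deg a2 h2.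
have := off_next_deg a3 h3; have := off_next_deg a4 h4.
have := off_common n21 a1 a2; have := off_common n31 a1 a3.
have := off_common n41 a1 a4; have := off_common n42 a2 a4.
have n32 : w3 != w2 by rewrite eq_sym.
have n43 : w4 != w3 by rewrite eq_sym.
have := off_common n32 a2 a3; have := off_common n43 a3 a4; have := off_card.
do 6!move: (#|_ :&: _|) => ?.
move: (#|nbr (next c w1)|) (#|nbr (next c w2)|).
move: (#|nbr (next c w3)|) (#|nbr (next c w4)|) (#|G|).
clear; lia.
Qed.

End OffVertex.
End MaximalCycle.

(** * Light vertices on a common cycle *)

Lemma light_heavy v : v \in light -> v \notin heavy.
Proof. rewrite !inE => /andP[+ _]; rewrite -ltnNge; lia. Qed.

Lemma maximal_indep S : exists I, [/\ I \subset S, indep I & S \subset I :|: nbrs I].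
Proof.
pose P I := (I \subset S) && [forall x in I, forall y in I, ~~ adj x y].
have PP I : reflect ((I \subset S) /\ indep I) (P I).
  apply: (iffP andP) => [[IS /forall_inP Iind]|[IS Iind]]; split=> //.
    by move=> x y Ix Iy; have /forall_inP := Iind x Ix; apply.
  by apply/forall_inP => x Ix; apply/forall_inP => y Iy; apply: Iind.
have [|I /maxsetP[/PP[IS Iind] Imax]] := @ex_maxset _ P.
  by exists set0; apply/PP; split; [rewrite sub0set|move=> x y; rewrite inE].
exists I; split=> //; apply/subsetP => x Sx; apply/negPn/negP.
rewrite in_setU negb_or => /andP[Ix nIx].
have nx y : y \in I -> ~~ adj x y.
  move=> Iy; apply: contra nIx => xy; apply/bigcupP; exists y => //.
  by rewrite in_nbr adj_sym.
have /Imax : P (x |: I).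
  apply/PP; split; first by rewrite subUset sub1set Sx.
  move=> y z; rewrite !in_setU1 => /orP[/eqP->|Iy] /orP[/eqP->|Iz].
  - by rewrite adj_irr.
  - exact: nx.
  - by rewrite adj_sym nx.
  - exact: Iind.
by move=> E; case/negP: Ix; rewrite -E ?setU11 // subsetUr.
Qed.

(** For a maximal independent [I] in [S] with at least two vertices, [nbrs I] has at least
    [15 * #|I|] vertices, at most [3 * #|I|] of them not heavy. So [#|S| <= 4 * #|I|], against at
    least [12 * #|I|] heavy neighbours. *)
Lemma light_heavy_nbrs S : S \subset light -> 2 * #|S| <= #|nbrs S :&: heavy|.
Proof.
move=> Sl; have [I [IS Iind SI]] := maximal_indep S.
have Il v : v \in I -> v \in light by move=> Iv; apply/(subsetP Sl)/(subsetP IS).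
have few : #|nbrs I :\: heavy| <= #|I| * 3.
  rewrite /nbrs setDE big_distrl /=; apply: card_bigcup_le => v /Il.
  by rewrite inE -setDE => /andP[].
have SD : #|S| <= #|I| + #|nbrs I :\: heavy|.
  apply: leq_trans (leq_card_setU _ _).1; apply: subset_leq_card.
  apply/subsetP => v Sv; have := subsetP SI v Sv; rewrite !in_setU in_setD.
  by rewrite (light_heavy (subsetP Sl v Sv)).
have mono : #|nbrs I :&: heavy| <= #|nbrs S :&: heavy|.
  apply/subset_leq_card/setSI/bigcupsP => v Iv.
  by apply: bigcup_sup; apply: (subsetP IS).
have := cardsID heavy (nbrs I).
have [I1|] := ltnP 1 #|I|; first by have := indep_nbrs Iind I1; lia.
case: (posnP #|I|) => [I0|I0 I1]; first by lia.
have /cards1P[v Ev] : #|I| == 1 by rewrite eqn_leq I1.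
have : v \in light by rewrite Il // Ev set11.
rewrite inE => /andP[dv _].
(* A single [v] has small degree, hence a non-neighbour, hence at least 30 neighbours; at least 27
   of them are heavy. *)
have [z] : exists z, z \notin v |: nbr v.
  apply/existsP; rewrite -negb_forall; apply/negP => /forallP all_v.
  have : #|G| <= #|v |: nbr v| by apply/subset_leq_card/subsetP => z _; apply: all_v.
  by have := (leq_card_setU [set v] (nbr v)).1; rewrite cards1; lia.
rewrite in_setU1 in_nbr negb_or eq_sym => /andP[vz avz].
have := nonadj_deg vz avz; rewrite /nbrs Ev big_set1 cards1 in mono SD few *; lia.
Qed.

(** Hall's theorem on pairs of a light vertex and a boolean gives each light vertex two private
    heavy neighbours. The resulting blocks heavy, light, heavy are chained by edges between heavy
    vertices. *)
Lemma light_cycle : light != set0 ->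
  exists2 c, ucycle cadj c & {subset light <= c}.
Proof.
move=> l0; pose L := {v | v \in light}.
pose A (i : L * bool) := nbr (val i.1) :&: heavy.
have [f fI fA] : exists2 f, injective f & forall i, f i \in A i.
  apply: hall => J; pose S : {set G} := [set val i.1 | i in J].
  have Sl : S \subset light by apply/subsetP => _ /imsetP[i _ ->]; apply: valP.
  have -> : \bigcup_(i in J) A i = nbrs S :&: heavy.
    rewrite /nbrs big_distrl /=; apply/setP => z; apply/bigcupP/bigcupP.
      by case=> i Ji Az; exists (val i.1) => //; apply: imset_f.
    by case=> _ /imsetP[i Ji ->] Az; exists i.
  apply: leq_trans (light_heavy_nbrs Sl).
  pose h (i : L * bool) := (val i.1, i.2).
  have hI : injective h by move=> [v k] [v' k'] [/val_inj-> ->].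
  rewrite -(card_imset _ hI) -card_bool mulnC -cardsT -cardsX.
  apply: subset_leq_card; apply/subsetP => _ /imsetP[i Ji ->].
  by rewrite in_setX in_setT andbT; apply: imset_f.
pose g (i : L * option bool) := if i.2 is Some k then f (i.1, k) else val i.1.
have fh i : f i \in heavy by have := fA i; rewrite in_setI => /andP[].
have fv (l : L) k : cadj (val l) (f (l, k)).
  by have := fA (l, k); rewrite in_setI in_nbr => /andP[/adj_cadj].
have vf (l : L) i : val l <> f i.
  by move=> E; have := light_heavy (valP l); rewrite E fh.
have gI : injective g.
  move=> [v [k|]] [v' [k'|]]; rewrite /g /=.
  - by move/fI=> [-> ->].
  - by move/esym/vf.
  - by move/vf.
  - by move/val_inj->.
have ff i j : i != j -> cadj (f i) (f j).
  by move=> nij; rewrite /cadj !fh (inj_eq fI) nij orbT.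
pose blk := [:: Some false; None; Some true].
pose c (vs : seq L) := [seq g (l, k) | l <- vs, k <- blk].
have wc l vs :
    walk cadj (f (l, false)) (f (last l vs, true)) (c (l :: vs)).
  elim: vs l => [|v' vs IH] v.
    by rewrite /c /= /g /= !eqxx fv cadj_sym fv.
  have wv : walk cadj (f (v, false)) (f (v, true)) (c [:: v]).
    by rewrite /c /= /g /= !eqxx fv cadj_sym fv.
  by apply: (walk_cat wv _ (IH v')); apply: ff; rewrite xpair_eqE andbF.
have [v0 l_v0] := set0Pn _ l0.
have v0L : (Sub v0 l_v0 : L) \in enum {: L} by rewrite mem_enum.
exists (c (enum {: L})); last first.
  move=> v lv; apply/allpairsP; exists (Sub v lv : L, None).
  by split; rewrite /= ?mem_enum ?inE.
apply/andP; split; last first.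
  apply: allpairs_uniq; rewrite ?enum_uniq //.
  by move=> [i k] [j k'] _ _ /gI.
case: (enum _) v0L => // v vs _.
(* The ends carry different booleans, so they are distinct even for a single block. *)
by apply: (walk_cycle (wc v vs)); apply: ff; rewrite xpair_eqE andbF.
Qed.

(** * Longest cycles through the light vertices *)

Lemma start_cycle : 1 < #|G| ->
  exists c, [/\ ucycle cadj c, c != [::] & {subset light <= c}].
Proof.
move=> G1; have [l0|l0] := eqVneq light set0; last first.
  have [c uc lc] := light_cycle l0; exists c; split=> //.
  have [v lv] := set0Pn _ l0.
  by apply/eqP => E; have := lc v lv; rewrite E.
have [a [b ab]] : exists a b : G, adj a b.
  have /card_gt1P[x [y [_ _ nxy]]] := G1.
  have [xy|nxy'] := boolP (adj x y); first by exists x, y.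
  have : 0 < #|nbr x| by apply: leq_trans (nonadj_deg nxy nxy').
  by case/card_gt0P=> z; rewrite in_nbr; exists x, z.
(* an edge traversed back and forth is a [ucycle] *)
exists [:: a; b]; split=> //; last by move=> v; rewrite l0 inE.
have nab : a != b by apply: contraTneq ab => ->; rewrite adj_irr.
by rewrite /ucycle /= !adj_cadj // 1?adj_sym // inE nab.
Qed.

Lemma longest_cycle S c0 : ucycle cadj c0 -> {subset S <= c0} ->
  exists c, [/\ ucycle cadj c, {subset S <= c}, size c0 <= size c &
    forall c', ucycle cadj c' -> {subset c <= c'} -> size c' <= size c].
Proof.
move=> uc0 Sc0; pose P k := [exists t : k.-tuple G, ucycleb cadj t && (S \subset t)].
have toP c : ucycle cadj c -> {subset S <= c} -> P (size c).
  by move=> uc Sc; apply/existsP; exists (in_tuple c); apply/andP; split=> //;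
    apply/subsetP.
have Pn k : P k -> k <= #|G|.
  case/existsP=> t /andP[/andP[_ ut] _]; rewrite -(size_tuple t) -(card_uniqP ut).
  exact: max_card.
have exP : exists k, P k by exists (size c0); apply: toP.
have [k /existsP[t /andP[ut /subsetP St]] kmax] := ex_maxnP exP Pn.
exists t; rewrite size_tuple; split=> //; first by apply: kmax; apply: toP.
by move=> c' uc' tc'; apply/kmax/toP => // v /St; apply: tc'.
Qed.

(** A vertex missed by a longest cycle through all light vertices would itself be light, hence on
    the cycle. *)
Lemma tough_hamiltonian : 2 < #|G| -> hamiltonian G.
Proof.
move=> G3; have [c0 [uc0 c00 lc0]] := start_cycle (ltnW G3).
have [c [uc lc c0c cmax]] := longest_cycle uc0 lc0.
have c_n0 : c != [::] by rewrite -size_eq0 -lt0n (leq_trans _ c0c) // lt0n size_eq0.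
have call u : u \in c.
  by apply/negPn/negP => nuc; case/negP: (nuc); apply/lc/(off_light uc c_n0 cmax nuc).
have deg_large x y : cadj x y -> ~~ adj x y -> #|G| <= 2 * #|[set z | adj x z]|.
  by rewrite /cadj => /orP[->//|/and3P[_ + _] _]; rewrite inE.
have [c' uc' c'all] := ore_closure (@adj_sym G) (@adj_irr G) cadj_sym adj_cadj
  deg_large uc call c_n0.
exists c' => //; split=> //; apply: leq_trans G3 _.
by apply: leq_trans (card_size c'); apply/subset_leq_card/subsetP => v _; apply: c'all.
Qed.

End ToughFree.

Theorem theorem1p1 (R : realType) (G : sgraph) :
  tough (15%:R : R)%R G ->
  induced_free (dunion (path_graph 2) (path_graph 3)) G ->
  3 <= #|G| ->
  hamiltonian G.
Proof.
by move=> /toughP toughG /induced_free23 freeG; apply: tough_hamiltonian.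
Qed.
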